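(* Let $S$ be a DR-semigroup. The following implication holds for all $x,y\in S$, $$\bigl(D(xy)=D(x)\ \text{and}\ R(xy)=R(y)\bigr)\ \Rightarrow\ R(x)=D(y),$$ if and only if $S$ satisfies the ample conditions.
   Context: A DR-semigroup is a semigroup $S$ with two unary operations $D,R$ satisfying the laws: (DR1) $D(x)x=x$; (DR2) $xR(x)=x$; (DR3) $R(D(x))=D(x)$, $D(R(x))=R(x)$; (DR4) $D(x)D(xy)=D(xy)D(x)=D(xy)$; (DR5) $R(y)R(xy)=R(xy)R(y)=R(xy)$. Put $D(S)=\{D(s)\mid s\in S\}$. $S$ satisfies the ample conditions if $xe=D(xe)x$ and $ex=xR(ex)$ for all $x\in S$, $e\in D(S)$. *)

(* Defs.v *)
From mathcomp Require Import all_boot.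
From mathcomp Require Import monoid.

Set Implicit Arguments.
Unset Strict Implicit.
Unset Printing Implicit Defensive.

Local Open Scope group_scope.

(* The carrier is a [magmaType], with associativity as an axiom of the record,
   because the library's [semigroupType] also requires a [choiceType]. *)
Record is_DR_semigroup (S : magmaType) (D R : S -> S) : Prop := IsDRSemigroup {
  DR_mulA : associative (@mul S);
  DR1 : forall x : S, D x * x = x;
  DR2 : forall x : S, x * R x = x;
  DR3 : forall x : S, R (D x) = D x /\ D (R x) = R x;
  DR4 : forall x y : S,
    D x * D (x * y) = D (x * y) /\ D (x * y) * D x = D (x * y);
  DR5 : forall x y : S,
    R y * R (x * y) = R (x * y) /\ R (x * y) * R y = R (x * y)
}.

Definition D_image (S : magmaType) (D : S -> S) (e : S) : Prop :=
  exists s : S, e = D s.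

Definition ample (S : magmaType) (D R : S -> S) : Prop :=
  forall x e : S, D_image D e ->
    x * e = D (x * e) * x /\ e * x = x * R (e * x).

(* Main.v *)
Require Import Defs.
From mathcomp Require Import all_boot.
From mathcomp Require Import monoid.

Local Open Scope group_scope.

(** Order the projections by [e <= f] iff [f * e = e] and [e * f = e]. The laws
    DR4 and DR5 say that [D (x * y) <= D x] and [R (x * y) <= R y].

    Suppose the ample conditions, [D (x * y) = D x] and [R (x * y) = R y]. Then
    [D (x * y) <= D (x * D y) <= D x] forces [D (x * D y) = D x], and ampleness
    turns this into [x * D y = x]; hence [R x = R (x * D y) <= D y]. Dually,
    [R x * y = y] and [D y <= R x], and antisymmetry concludes.

    Conversely, suppose the implication, and let [e] be a projection. The
    element [x * e] factors as [u * v] with [u := D (x * e) * x] and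
    [v := R (x * e)], and this factorization satisfies the premises of the
    implication ([D_restriction], [restriction_factor]). So [R u = R (x * e)],
    and then [u = u * R u = u * v = x * e]. The other ample condition is dual. *)

Section DRSemigroup.

Variables (S : magmaType) (D R : S -> S).
Hypothesis hS : is_DR_semigroup D R.

Let mulA : associative (@mul S) := DR_mulA hS.

Lemma D_idem x : D (D x) = D x.
Proof.
have [RD _] := DR3 hS x; have [_ DR] := DR3 hS (D x).
by move: DR; rewrite RD.
Qed.

Lemma R_idem x : R (R x) = R x.
Proof.
have [_ DR] := DR3 hS x; have [RD _] := DR3 hS (R x).
by move: RD; rewrite DR.
Qed.

Lemma D_image_fixed e : D_image D e -> D e = e /\ R e = e.
Proof. by case=> s ->; rewrite D_idem (DR3 hS s).1. Qed.

(** In the chain [D (x * y * z) <= D (x * y) <= D x], equal ends force the middle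
    term to agree with them. *)
Lemma D_squeeze x y z : D (x * y * z) = D x -> D (x * y) = D x.
Proof.
move=> eqD; have [le_xyz _] := DR4 hS (x * y) z; have [_ le_xy] := DR4 hS x y.
by rewrite -le_xy -eqD le_xyz.
Qed.

Lemma R_squeeze x y z : R (x * (y * z)) = R z -> R (y * z) = R z.
Proof.
move=> eqR; have [_ le_xyz] := DR5 hS x (y * z); have [le_yz _] := DR5 hS y z.
by rewrite -le_yz -eqR le_xyz.
Qed.

(** This is [D_squeeze] for the product [D (x * y) * x * y], which equals
    [x * y] by DR1. *)
Lemma D_restriction x y : D (D (x * y) * x) = D (x * y).
Proof.
rewrite -[RHS]D_idem; apply: (@D_squeeze _ x y).
by rewrite -mulA (DR1 hS) D_idem.
Qed.

Lemma R_restriction x y : R (y * R (x * y)) = R (x * y).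
Proof.
rewrite -[RHS]R_idem; apply: (@R_squeeze x y).
by rewrite mulA (DR2 hS) R_idem.
Qed.

(** The projection [e] can be inserted before [R (x * e)], because
    [R (x * e) <= R e = e]. *)
Lemma restriction_factor x e :
  R e = e -> D (x * e) * x * R (x * e) = x * e.
Proof.
move=> Re; have [] := DR5 hS x e; rewrite Re => le_e _.
by rewrite -le_e mulA -(mulA _ x e) (DR1 hS) (DR2 hS).
Qed.

Lemma corestriction_factor x e :
  D e = e -> D (e * x) * (x * R (e * x)) = e * x.
Proof.
move=> De; have [_] := DR4 hS e x; rewrite De => le_e.
by rewrite -le_e -mulA (mulA e) (DR2 hS) (DR1 hS).
Qed.

Lemma ample_of_implication :
  (forall x y, D (x * y) = D x /\ R (x * y) = R y -> R x = D y) -> ample D R.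
Proof.
move=> impl x e /D_image_fixed[De Re]; split.
- have fac := restriction_factor x e Re.
  have Ru : R (D (x * e) * x) = R (x * e).
    rewrite -[RHS](DR3 hS _).2; apply: impl.
    by rewrite fac D_restriction R_idem.
  by rewrite -[RHS](DR2 hS) Ru fac.
- have fac := corestriction_factor x e De.
  have Du : D (x * R (e * x)) = D (e * x).
    rewrite -[RHS](DR3 hS _).1; apply/esym/impl.
    by rewrite fac R_restriction D_idem.
  by rewrite -[RHS](DR1 hS) Du fac.
Qed.

Lemma implication_of_ample x y :
  ample D R -> D (x * y) = D x -> R (x * y) = R y -> R x = D y.
Proof.
move=> amp eqD eqR.
have xDy : x * D y = x.
  have [-> _] := amp x (D y) (ex_intro _ y erefl).
  by rewrite (@D_squeeze x (D y) y) ?(DR1 hS) // -mulA (DR1 hS).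
have Rxy : R x * y = y.
  (* [R x] is a value of [D] because [D (R x) = R x] *)
  have [_ ->] := amp y (R x) (ex_intro _ (R x) (esym (DR3 hS x).2)).
  by rewrite (@R_squeeze x (R x) y) ?(DR2 hS) // mulA (DR2 hS).
(* the two order relations give the same product [R x * D y] *)
have [_] := DR5 hS x (D y); rewrite xDy (DR3 hS y).1 => <-.
by have [] := DR4 hS (R x) y; rewrite Rxy (DR3 hS x).2.
Qed.

End DRSemigroup.

Theorem theorem4p1 (S : magmaType) (D R : S -> S)
    (hS : is_DR_semigroup D R) :
  (forall x y : S, (D (x * y) = D x /\ R (x * y) = R y) -> R x = D y)
  <-> ample D R.
Proof.
split; first exact: ample_of_implication.
by move=> amp x y [eqD eqR]; apply: implication_of_ample.
Qed.
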